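(* For every integer $n\ge 6$, $K(\lfloor 1.53\, n\rfloor,4)\ge 40\cdot 3^{(n-8)/3}$, and hence $K(n,4)\ge 40\cdot 3^{(\lfloor 0.6535\, n \rfloor-8)/3}$.
   Context: $I(n)$ denotes the graph of the $n$-dimensional hypercube: vertices are binary vectors of length $n$, two vertices adjacent iff they differ in exactly one coordinate. For an induced subgraph $G$ of $I(n)$ and vertices $x,x'$ of $G$, $d_G(x,x')$ is the length of a shortest path from $x$ to $x'$ in $G$; $d_{I(n)}(x,x')$ is the Hamming distance. An induced subgraph $C$ of $I(n)$ is an $(n,k)$ circuit code (circuit code of spread $k$) if $C$ is a cycle and for all vertices $x,x'$ of $C$ with $d_{I(n)}(x,x')<k$ we have $d_C(x,x')=d_{I(n)}(x,x')$. The length of a circuit code is its number of vertices. $K(n,k)$ denotes the maximum length of an $(n,k)$ circuit code. *)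

(* Defs.v *)
From mathcomp Require Import all_boot.
Set Implicit Arguments.
Unset Strict Implicit.
Unset Printing Implicit Defensive.

(* Length of a shortest path from x to y in the graph (T, e).  A shortest path
   has fewer than #|T| edges; the value is #|T| when y is unreachable from x. *)
Definition gdist (T : finType) (e : rel T) (x y : T) : nat :=
  find (fun m => [exists p : m.-tuple T, path e x p && (last x p == y)])
       (iota 0 #|T|).

(* The graph with vertex set C and edge relation e is a cycle: its vertices can
   be listed cyclically, without repetition, so that the edges are exactly the
   pairs of consecutive vertices. *)
Definition is_cycle (T : finType) (C : {set T}) (e : rel T) : bool :=
  (2 < #|C|) &&
  [exists s : #|C|.-tuple T,
    [&& uniq s, [set x in s] == C
      & [forall x in C, forall y in C,
          e x y == (y == next s x) || (x == next s y)]]].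

Definition hamming n (x y : n.-tuple bool) : nat :=
  #|[set i : 'I_n | tnth x i != tnth y i]|.

Definition cube_adj n : rel (n.-tuple bool) := fun x y => hamming x y == 1.

(* An induced subgraph of the n-cube is given by its vertex set. *)
Definition induced_adj n (C : {set n.-tuple bool}) : rel (n.-tuple bool) :=
  [rel x y in C | cube_adj x y].

(* The distance in the whole cube is the Hamming distance. *)
Definition circuit_code n k (C : {set n.-tuple bool}) : bool :=
  is_cycle C (induced_adj C) &&
  [forall x in C, forall y in C,
    (hamming x y < k) ==> (gdist (induced_adj C) x y == hamming x y)].

(* K n k = 0 when there is no (n, k) circuit code, i.e. when n < 2. *)
Definition K (n k : nat) : nat :=
  \max_(C : {set n.-tuple bool} | circuit_code k C) #|C|.

(* Main.v *)
Require Import Defs.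
From mathcomp Require Import all_boot all_order all_algebra zify lra.
From mathcomp Require Import reals exp.
Set Implicit Arguments.
Unset Strict Implicit.
Unset Printing Implicit Defensive.
Import Order.TTheory GRing.Theory Num.Theory.

(* A circuit code of spread 4 and length [a] in I(d), together with the
   10-cycle of I(5) with transitions 0 1 2 3 4 0 1 2 3 4, spans an a x 10 torus
   inside I(d + 5), on which the Hamming distance, as long as it is below 4, is
   the L1 distance.  A monotone staircase that climbs [h = 5 (mod 10)] units per
   turn around the first factor, with at most one unit in each column, closes
   up after two turns, and its two turns are vertical translates of each other
   by 5, hence at L1 distance at least 4.  So length [a] in dimension [d] gives
   length [2 (a + h)], about [4 a], in dimension [d + 5].  Three such steps add
   15 dimensions, fewer than 1.53 * 10, and multiply the length by at least 39,
   while 39 ^ 3 >= 3 ^ 10; hence the bound passes from n to n + 10, and only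
   6 <= n < 16 is left, where it follows from staircases over small codes. *)

Local Open Scope nat_scope.

(** * Hamming distance of bit sequences *)

Definition hdist (s t : seq bool) : nat :=
  count (fun p => p.1 != p.2) (zip s t).

Lemma hdistC s t : hdist s t = hdist t s.
Proof.
elim: s t => [|x s IHs] [|y t] //; rewrite /hdist /= -!/(hdist _ _) IHs.
by rewrite eq_sym.
Qed.

Lemma hdist_cat s1 s2 t1 t2 : size s1 = size t1 ->
  hdist (s1 ++ s2) (t1 ++ t2) = hdist s1 t1 + hdist s2 t2.
Proof. by move=> eq_sz; rewrite /hdist zip_cat // count_cat. Qed.

Lemma hdistxx s : hdist s s = 0.
Proof. by elim: s => // x s; rewrite /hdist /= eqxx. Qed.

Lemma hdist_triangle t s u : size s = size t -> size t = size u ->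
  hdist s u <= hdist s t + hdist t u.
Proof.
elim: t s u => [|y t IHt] [|x s] [|z u] //= [st] [tu].
have := IHt s u st tu; rewrite /hdist /=.
by case: x y z => [] [] [] /=; lia.
Qed.

Lemma hammingE n (x y : n.-tuple bool) : hamming x y = hdist x y.
Proof.
rewrite /hamming /hdist -[in RHS](map_tnth_enum x) -[in RHS](map_tnth_enum y).
rewrite zip_map count_map -size_filter cardsE cardE /enum_mem -filter_predI.
by congr size; apply: eq_filter => i; rewrite /= andbT.
Qed.

(** * Closed walks in the cube and their spread *)

Lemma modnMDr p m d : m + p * d = m %[mod d].
Proof. by rewrite addnC modnMDl. Qed.

(* [i] and [j] are [t] steps apart on the cycle Z/N, in one of the two
   directions; [t] need not be the shorter way around. *)
Definition near (N t i j : nat) : bool :=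
  (i + t == j %[mod N]) || (j + t == i %[mod N]).

Lemma nearC N t i j : near N t i j = near N t j i.
Proof. by rewrite /near orbC. Qed.

Lemma near_mod N t i i' j j' : i = i' %[mod N] -> j = j' %[mod N] ->
  near N t i j = near N t i' j'.
Proof.
move=> eq_i eq_j; rewrite /near eq_i eq_j.
by rewrite -(modnDml i) eq_i modnDml -(modnDml j) eq_j modnDml.
Qed.

(** For [k > 1], distance 0 in [wc_near] makes [w] injective modulo [N], and distance 1 excludes
    chords. *)
Record walk_code (k d N : nat) (w : nat -> seq bool) : Prop := WalkCode {
  wc_size : forall i, size (w i) = d;
  wc_mod : forall i j, i = j %[mod N] -> w i = w j;
  wc_step : forall i, hdist (w i) (w i.+1) = 1;
  wc_near : forall i j,
    hdist (w i) (w j) < k -> near N (hdist (w i) (w j)) i j }.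

Lemma walk_code_pad k d d' N w : d <= d' -> walk_code k d N w ->
  walk_code k d' N (fun i => w i ++ nseq (d' - d) false).
Proof.
move=> le_dd' [sz md st nr].
have E i j : hdist (w i ++ nseq (d' - d) false) (w j ++ nseq (d' - d) false)
   = hdist (w i) (w j).
  by rewrite hdist_cat ?sz // hdistxx addn0.
split=> [i|i j /md->|i|i j] //; rewrite ?E //; last exact: nr.
by rewrite size_cat size_nseq sz subnKC.
Qed.

(** * Explicit codes from transition sequences *)

Definition transition_walk (d : nat) (T : seq nat) (i : nat) : seq bool :=
  mkseq (fun c => odd (count_mem c (take (i %% size T) T))) d.

(** The step test at [i = N - 1] wraps to vertex 0, so it also checks that the walk closes up. [V]
    tabulates the vertices for the quadratic test. *)
Definition transition_check (k d : nat) (T : seq nat) : bool :=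
  let N := size T in
  let V := map (transition_walk d T) (iota 0 N) in
  [&& 0 < N,
   all (fun i => hdist (transition_walk d T i) (transition_walk d T i.+1) == 1)
     (iota 0 N) &
   all (fun i => all (fun j => let D := hdist (nth [::] V i) (nth [::] V j) in
      (D < k) ==> near N D i j) (iota 0 N)) (iota 0 N)].

Lemma transition_checkP k d T : transition_check k d T ->
  walk_code k d (size T) (transition_walk d T).
Proof.
case/and3P=> N0 /allP st /allP nr.
have wE i : transition_walk d T i = transition_walk d T (i %% size T).
  by rewrite /transition_walk modn_mod.
have wM i j : i = j %[mod size T] -> transition_walk d T i = transition_walk d T j.
  by move=> eq_ij; rewrite wE eq_ij -wE.
have ltm i : i %% size T < size T by rewrite ltn_mod.
split=> [i|//|i|i j]; first by rewrite size_mkseq.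
  have := st (i %% size T); rewrite mem_iota /= add0n ltm => /(_ isT) /eqP.
  rewrite -wE => <-; congr hdist; apply: wM.
  by rewrite -addn1 -[in RHS]addn1 modnDml.
have := nr (i %% size T); rewrite mem_iota /= add0n ltm => /(_ isT) /allP.
move/(_ (j %% size T)); rewrite mem_iota /= add0n ltm => /(_ isT).
rewrite !(nth_map 0) ?size_iota // !nth_iota // !add0n -!wE.
by move=> /implyP/[apply]; rewrite (near_mod _ (modn_mod i _) (modn_mod j _)).
Qed.

Lemma walk_code_cross4 : walk_code 4 4 8 (transition_walk 4 (iota 0 4 ++ iota 0 4)).
Proof. by apply: (@transition_checkP 4 4 (iota 0 4 ++ iota 0 4)); vm_compute. Qed.

Lemma walk_code_cross5 : walk_code 4 5 10 (transition_walk 5 (iota 0 5 ++ iota 0 5)).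
Proof. by apply: (@transition_checkP 4 5 (iota 0 5 ++ iota 0 5)); vm_compute. Qed.

Lemma walk_code_cross8 : walk_code 4 8 16 (transition_walk 8 (iota 0 8 ++ iota 0 8)).
Proof. by apply: (@transition_checkP 4 8 (iota 0 8 ++ iota 0 8)); vm_compute. Qed.

(* Found by computer search among the sequences invariant, up to a permutation
   of the 11 coordinates, under a shift by 4. *)
Definition transitions_11_40 : seq nat :=
  [:: 1; 3; 6; 10; 0; 1; 8; 4; 6; 0; 5; 9; 8; 6; 10; 2; 5; 8; 4; 3;
      10; 5; 9; 1; 4; 10; 2; 0; 9; 4; 3; 6; 2; 9; 1; 8; 3; 2; 0; 5].

Lemma walk_code_11_40 : walk_code 4 11 40 (transition_walk 11 transitions_11_40).
Proof. by apply: (@transition_checkP 4 11 transitions_11_40); vm_compute. Qed.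

(** * The staircase on the torus *)

Section Staircase.

Variables a h : nat.
Hypothesis h_gt0 : 0 < h.
Hypothesis le_ha : h <= a.

(* The staircase repeats, with period [a + h], the pattern: [h] times a step in
   x then a step in y, followed by [a - h] steps in x. *)
Definition stair_y (s : nat) : nat :=
  s %/ (a + h) * h + minn (s %% (a + h))./2 h.

Definition stair_x (s : nat) : nat := s - stair_y s.

(** Since [h <= a], the minimum has reached [h] when the period ends, so the formula survives one
    step beyond the next period's start; [u], [u + 1], [u + 2] can thus share one quotient [q]. *)
Lemma stair_yE q u : u <= (a + h).+1 ->
  stair_y (q * (a + h) + u) = q * h + minn u./2 h.
Proof.
move=> le_u; have L0 : 1 < a + h by lia.
rewrite /stair_y divnMDl ?modnMDl; last lia.
have [u_lt|u_ge] := ltnP u (a + h).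
  by rewrite divn_small // modn_small // addn0.
have [v -> v_le] : exists2 v, u = a + h + v & v <= 1.
  by exists (u - (a + h)); lia.
rewrite divnDl // divnn modnDl (divn_small (m := v)) ?modn_small; try lia.
Qed.

Lemma stair_yD q s : stair_y (s + q * (a + h)) = stair_y s + q * h.
Proof. by rewrite /stair_y [s + _]addnC divnMDl ?modnMDl; lia. Qed.

Lemma stair_y_step s :
  [/\ stair_y s <= stair_y s.+1, stair_y s.+1 <= (stair_y s).+1
    & stair_y s.+2 <= (stair_y s).+1].
Proof.
rewrite (divn_eq s (a + h)); have: s %% (a + h) < a + h by rewrite ltn_mod; lia.
move: (s %/ _) (s %% _) => q u u_lt.
have E0 := @stair_yE q u; have E1 := @stair_yE q u.+1; have E2 := @stair_yE q u.+2.
rewrite !addnS in E1 E2; rewrite E0 ?E1 ?E2; try lia.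
by split; lia.
Qed.

Lemma leq_stair_y s t : stair_y s <= stair_y (s + t).
Proof.
elim: t => [|t IHt]; first by rewrite addn0.
by rewrite addnS; case: (stair_y_step (s + t)); lia.
Qed.

(** Of two consecutive steps at most one climbs, hence the induction by two. *)
Lemma stair_y_slope s t : stair_y (s + t) <= stair_y s + uphalf t.
Proof.
elim/ltn_ind: t => -[|[|t]] IHt; first by rewrite !addn0.
  by rewrite addn1 /=; case: (stair_y_step s); lia.
have /(_ (ltnW (ltnSn _))) := IHt t; case: (stair_y_step (s + t)).
by have -> : uphalf t.+2 = (uphalf t).+1 by []; rewrite !addnS; lia.
Qed.

Lemma stair_y_le s : stair_y s <= s.
Proof.
have := stair_y_slope 0 s; rewrite add0n {2}/stair_y div0n mod0n /=; lia.
Qed.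

Lemma stair_xy s : stair_x s + stair_y s = s.
Proof. by rewrite subnK // stair_y_le. Qed.

Lemma stair_xD q s : stair_x (s + q * (a + h)) = stair_x s + q * a.
Proof. have := stair_xy (s + q * (a + h)); have := stair_xy s; rewrite stair_yD; lia. Qed.

Hypothesis h5 : h = 5 %[mod 10].

Lemma stair_period_y q s :
  stair_y (s + q * (2 * (a + h))) = stair_y s %[mod 10].
Proof.
rewrite mulnA stair_yD -mulnA -modnDmr.
suff -> : q * (2 * h) %% 10 = 0 by rewrite addn0.
by apply/eqP/dvdn_mull; lia.
Qed.

Lemma stair_period_x q s :
  stair_x (s + q * (2 * (a + h))) = stair_x s %[mod a].
Proof. by rewrite mulnA stair_xD modnMDr. Qed.

(* [k] counts the turns by which [t] has been moved to realise the distance [D1]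
   in x: an odd number of them would shift y by 5 modulo 10, too far for [D2]. *)
Lemma stair_lift D1 D2 k s t : D1 + D2 < 4 ->
    stair_x s + D1 = stair_x t -> near 10 D2 (stair_y s) (stair_y t + 5 * k) ->
  ~~ odd k /\ (s + (D1 + D2) = t \/ t + (D1 + D2) = s).
Proof.
have := stair_xy s; have := stair_xy t.
have slope_st : s <= t -> stair_y s <= stair_y t <= stair_y s + uphalf (t - s).
  move=> le_st; have := leq_stair_y s (t - s); have := stair_y_slope s (t - s).
  by rewrite subnKC // => -> ->.
have slope_ts : t <= s -> stair_y t <= stair_y s <= stair_y t + uphalf (s - t).
  move=> le_ts; have := leq_stair_y t (s - t); have := stair_y_slope t (s - t).
  by rewrite subnKC // => -> ->.
move: (stair_x s) (stair_x t) (stair_y s) (stair_y t) slope_st slope_ts.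
clear; rewrite /near => Xs Xt Ys Yt slope_st slope_ts.
(* Let [e] be the gap between [Ys] and [Yt]. If [s <= t], the slope gives [e <= D1 + 1], so
   [e + D2 <= 4], and [e + 5 * k] is [D2] or [-D2] modulo 10 only for even [k] and [e = D2]. If
   [t < s], the slope forces [D1 = 0] and [e = 1]. *)
have [le_st|lt_ts] := leqP s t.
  by have := slope_st le_st; lia.
by have := slope_ts (ltnW lt_ts); lia.
Qed.

Lemma stair_near_fwd D1 D2 s t : D1 + D2 < 4 ->
    stair_x s + D1 = stair_x t %[mod a] -> near 10 D2 (stair_y s) (stair_y t) ->
  near (2 * (a + h)) (D1 + D2) s t.
Proof.
move=> ltD eqX nrY; have dvd_h5 : 10 %| h + 5 by clear -h5; lia.
(* Moving [s] up by [t] periods puts its x above that of [t], so the congruence in x becomes an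
   equality after [k >= 0] turns of [t]. *)
pose s0 := s + t * (2 * (a + h)).
have eqm_s : s = s0 %[mod 2 * (a + h)] by rewrite /s0 modnMDr.
have eqX0 : stair_x s0 + D1 = stair_x t %[mod a].
  by rewrite -modnDml stair_period_x modnDml.
have [k Ek] : exists k, stair_x s0 + D1 = stair_x t + k * a.
  have le_t : stair_x t <= stair_x s0 + D1.
    have le_xt : stair_x t <= t by rewrite -[leqRHS]stair_xy leq_addr.
    have a_gt0 : 0 < 2 * a by rewrite muln_gt0 (leq_trans h_gt0 le_ha).
    apply: (leq_trans le_xt); apply: (leq_trans (leq_pmulr t a_gt0)).
    by rewrite /s0 !mulnA stair_xD addnAC leq_addl.
  have : a %| stair_x s0 + D1 - stair_x t.
    by rewrite -(eqn_mod_dvd _ le_t); apply/eqP.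
  by case/dvdnP=> k Ek; exists k; rewrite -Ek subnKC.
rewrite -stair_xD in Ek.
(* Each turn raises y by [h], which is -5 modulo 10; the term [5 * k] cancels this. *)
have nrY0 : near 10 D2 (stair_y s0) (stair_y (t + k * (a + h)) + 5 * k).
  rewrite (near_mod _ (stair_period_y _ _) (erefl _)) stair_yD.
  rewrite -(near_mod (j := stair_y t) _ (erefl _)) // -addnA -[LHS]modn_mod.
  rewrite -[in RHS]modnDmr; suff -> : (k * h + 5 * k) %% 10 = 0 by rewrite addn0 modn_mod.
  by rewrite [5 * k]mulnC -mulnDr; apply/eqP/dvdn_mull.
have [k_even Dst] := stair_lift ltD Ek nrY0.
(* An even number of turns is a whole number of periods. *)
have eqm_t : t = t + k * (a + h) %[mod 2 * (a + h)].
  have -> : k * (a + h) = k./2 * (2 * (a + h)).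
    by rewrite mulnA muln2 even_halfK.
  by rewrite modnMDr.
rewrite (near_mod _ eqm_s eqm_t) /near.
by case: Dst => ->; rewrite eqxx ?orbT.
Qed.

Lemma stair_near D1 D2 s t : D1 + D2 < 4 ->
    near a D1 (stair_x s) (stair_x t) -> near 10 D2 (stair_y s) (stair_y t) ->
  near (2 * (a + h)) (D1 + D2) s t.
Proof.
move=> ltD /orP[]/eqP eqX nrY; first exact: stair_near_fwd.
by rewrite nearC; apply: stair_near_fwd; rewrite // nearC.
Qed.

End Staircase.

(** Distances in the two blocks add up, so below 4 each factor converts its share into steps, and
    [stair_near] combines them. *)
Lemma walk_code_stair d1 d2 a h w b : h <= a -> h = 5 %[mod 10] ->
    walk_code 4 d1 a w -> walk_code 4 d2 10 b ->
  walk_code 4 (d1 + d2) (2 * (a + h))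
    (fun s => w (stair_x a h s) ++ b (stair_y a h s)).
Proof.
move=> le_ha h5 [sz md st nr] [szb mdb stb nrb].
have h0 : 0 < h by lia.
set v := fun s => _.
have vE s t : hdist (v s) (v t) = hdist (w (stair_x a h s)) (w (stair_x a h t))
    + hdist (b (stair_y a h s)) (b (stair_y a h t)).
  by rewrite hdist_cat ?sz.
have vD q s : v (s + q * (2 * (a + h))) = v s.
  by congr (_ ++ _); [apply: md; apply: stair_period_x
                     |apply: mdb; apply: stair_period_y].
split=> [s|s t|s|s t].
- by rewrite size_cat sz szb.
- move=> eq_st; rewrite (divn_eq s (2 * (a + h))) (divn_eq t (2 * (a + h))).
  by rewrite eq_st ![_ * (2 * _) + _]addnC !vD.
- rewrite vE; have := stair_xy h0 le_ha s; have := stair_xy h0 le_ha s.+1.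
  have [Y1 Y2 _] := stair_y_step h0 le_ha s.
  have [->|->] : stair_y a h s.+1 = stair_y a h s \/
                 stair_y a h s.+1 = (stair_y a h s).+1 by lia.
    move=> e1 e2; have -> : stair_x a h s.+1 = (stair_x a h s).+1 by lia.
    by rewrite st hdistxx.
  move=> e1 e2; have -> : stair_x a h s.+1 = stair_x a h s by lia.
  by rewrite stb hdistxx.
- rewrite vE => lt4; apply: stair_near => //; [apply: nr|apply: nrb]; lia.
Qed.

(** * From closed walks to circuit codes *)

Lemma hamming_path n (C : {set n.-tuple bool}) x p :
  path (induced_adj C) x p -> hamming x (last x p) <= size p.
Proof.
elim: p x => [|y p IHp] x /=; first by rewrite hammingE hdistxx.
case/andP=> /andP[_ /eqP xy] /IHp; move: xy; rewrite !hammingE => xy le_p.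
by apply: leq_trans (hdist_triangle (t := y) _ _) _; rewrite ?size_tuple // xy.
Qed.

Section WalkSet.

Variables (k d N : nat) (w : nat -> seq bool).
Hypotheses (k_gt1 : 1 < k) (N_gt2 : 2 < N) (le_kN : k <= N).
Hypothesis wP : walk_code k d N w.

Definition walk_vertex (i : nat) : d.-tuple bool :=
  Tuple (introT eqP (wc_size wP i)).

Local Notation v := walk_vertex.

Definition walk_set : {set d.-tuple bool} := [set x in mkseq v N].

Lemma hamming_walk i j : hamming (v i) (v j) = hdist (w i) (w j).
Proof. exact: hammingE. Qed.

Lemma walk_vertex_mod i j : i = j %[mod N] -> v i = v j.
Proof. by move/(wc_mod wP) => eq_w; apply: val_inj. Qed.

Lemma walk_vertex_inj i j : v i = v j -> i = j %[mod N].
Proof.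
move/(congr1 val) => /= eq_w; have := wc_near wP (i := i) (j := j).
rewrite eq_w hdistxx => /(_ (ltnW k_gt1)).
by rewrite /near !addn0 => /orP[]/eqP.
Qed.

Lemma uniq_walk : uniq (mkseq v N).
Proof.
apply/mkseq_uniqP => i j; rewrite !inE => lt_i lt_j /walk_vertex_inj.
by rewrite !modn_small.
Qed.

Lemma mem_walk_set i : v i \in walk_set.
Proof.
rewrite inE (@walk_vertex_mod i (i %% N)) ?modn_mod //.
by apply: map_f; rewrite mem_iota ltn_mod; lia.
Qed.

Lemma walk_setP x : x \in walk_set -> exists i, x = v i.
Proof. by rewrite inE => /mapP[i _ ->]; exists i. Qed.

Lemma card_walk_set : #|walk_set| = N.
Proof.
by rewrite cardsE (card_uniqP uniq_walk) size_mkseq.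
Qed.

Lemma next_walk i : next (mkseq v N) (v i) = v i.+1.
Proof.
have N0 : 0 < N by lia.
rewrite (@walk_vertex_mod i (i %% N)) ?modn_mod //.
rewrite (@walk_vertex_mod i.+1 (i %% N).+1); last first.
  by rewrite -addn1 -[in RHS]addn1 modnDml.
have: i %% N < N by rewrite ltn_mod.
move: (i %% N) => {}i lt_i.
have vi : v i \in mkseq v N by apply: map_f; rewrite mem_iota.
have ix : index (v i) (mkseq v N) = i.
  by rewrite -{1}(nth_mkseq (v 0) v lt_i) index_uniq ?size_mkseq ?uniq_walk.
rewrite next_nth vi ix.
have -> : mkseq v N = v 0 :: behead (mkseq v N) by case: (N) N0.
(* At the last vertex [nth] runs off the end and returns its default, the head [v 0]. *)
rewrite nth_behead; have [lt|ge] := ltnP i.+1 N; first by rewrite nth_mkseq.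
rewrite nth_default ?size_mkseq //; apply: walk_vertex_mod.
by have -> : i.+1 = N by [lia]; rewrite modnn mod0n.
Qed.

Lemma hamming1_walk i j :
  (hamming (v i) (v j) == 1) = (v j == v i.+1) || (v i == v j.+1).
Proof.
apply/idP/orP => [|[]/eqP->]; rewrite hamming_walk.
- move/eqP => h1; have := wc_near wP (i := i) (j := j); rewrite h1 => /(_ k_gt1).
  by rewrite /near !addn1 => /orP[]/eqP/walk_vertex_mod->; [left|right].
- by rewrite (wc_step wP).
- by rewrite hdistC (wc_step wP).
Qed.

Lemma walk_adj i : induced_adj walk_set (v i) (v i.+1).
Proof. by rewrite /induced_adj /= !mem_walk_set /cube_adj hamming1_walk eqxx. Qed.

Lemma walk_adjC x y : induced_adj walk_set x y = induced_adj walk_set y x.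
Proof.
rewrite /induced_adj /cube_adj /= !hammingE hdistC.
by case: (x \in _); case: (y \in _).
Qed.

Lemma walk_path i t :
  exists p : t.-tuple (d.-tuple bool),
    path (induced_adj walk_set) (v i) p /\ last (v i) p = v (i + t).
Proof.
elim: t i => [|t IHt] i; first by exists [tuple]; rewrite addn0.
have [p [pP lp]] := IHt i.+1; exists [tuple of v i.+1 :: p] => /=.
by rewrite walk_adj pP lp addSnnS.
Qed.

Lemma walk_path_rev i t :
  exists p : t.-tuple (d.-tuple bool),
    path (induced_adj walk_set) (v (i + t)) p /\ last (v (i + t)) p = v i.
Proof.
elim: t => [|t [p [pP lp]]]; first by exists [tuple]; rewrite addn0.
exists [tuple of v (i + t) :: p] => /=.
by rewrite addnS walk_adjC walk_adj pP lp.
Qed.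

Lemma gdist_walk i j : hamming (v i) (v j) < k ->
  gdist (induced_adj walk_set) (v i) (v j) = hamming (v i) (v j).
Proof.
move=> lt_k; set D := hamming _ _ in lt_k *.
(* [gdist] only searches lengths below the number of cube vertices; [D < k <= N] keeps [D] in
   range. *)
have lt_D : D < #|{: d.-tuple bool}|.
  by apply: leq_trans (max_card (mem walk_set)); rewrite card_walk_set; lia.
have ex_path : [exists p : D.-tuple (d.-tuple bool),
    path (induced_adj walk_set) (v i) p && (last (v i) p == v j)].
  have := wc_near wP (i := i) (j := j); rewrite -hamming_walk -/D => /(_ lt_k).
  case/orP=> /eqP/walk_vertex_mod E.
    by have [p [pP lp]] := walk_path i D; apply/existsP; exists p; rewrite pP lp E /=.
  have [p [pP lp]] := walk_path_rev j D.
  by apply/existsP; exists p; rewrite -E pP lp /=.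
rewrite /gdist; set P := fun m => _.
have min_P m : P m -> D <= m.
  case/existsP=> p /andP[pP /eqP lp].
  by have := hamming_path pP; rewrite lp size_tuple.
have hasP : has P (iota 0 #|{: d.-tuple bool}|).
  by apply/hasP; exists D; rewrite ?mem_iota.
have lt_find := hasP; rewrite has_find size_iota in lt_find.
have := nth_find 0 hasP; rewrite nth_iota // add0n => /min_P le_D.
apply/eqP; rewrite eqn_leq le_D andbT leqNgt; apply/negP => lt_Df.
have := before_find 0 lt_Df; rewrite nth_iota // add0n.
by rewrite /P ex_path.
Qed.

Lemma circuit_code_walk_set : circuit_code k walk_set.
Proof.
apply/andP; split; last first.
  apply/forall_inP => x /walk_setP[i ->]; apply/forall_inP => y /walk_setP[j ->].
  by apply/implyP => /gdist_walk ->.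
apply/andP; split; first by rewrite card_walk_set.
have sz : size (mkseq v N) == #|walk_set| by rewrite size_mkseq card_walk_set.
apply/existsP; exists (Tuple sz) => /=; rewrite uniq_walk eqxx /=.
apply/forall_inP => x /walk_setP[i ->]; apply/forall_inP => y /walk_setP[j ->].
by rewrite !next_walk /induced_adj /= !mem_walk_set /cube_adj hamming1_walk.
Qed.

Lemma walk_code_leq_K : N <= K d k.
Proof.
by rewrite -card_walk_set; apply: (leq_bigmax_cond _ circuit_code_walk_set).
Qed.

End WalkSet.

(** * Growth of the length under staircases *)

Definition has_code (d N : nat) : Prop := exists w, walk_code 4 d N w.

Lemma has_code_pad d d' N : d <= d' -> has_code d N -> has_code d' N.
Proof. by move=> le_d [w /(walk_code_pad le_d)]; eexists; eassumption. Qed.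

Lemma has_code_leq_K d N : 4 <= N -> has_code d N -> N <= K d 4.
Proof. by move=> N4 [w wP]; apply: (walk_code_leq_K _ _ _ wP); lia. Qed.

Lemma has_code_stair d a h : h <= a -> h = 5 %[mod 10] ->
  has_code d a -> has_code (d + 5) (2 * (a + h)).
Proof.
move=> le_ha h5 [w wP].
by eexists; apply: (walk_code_stair le_ha h5 wP walk_code_cross5).
Qed.

Lemma has_code_step d a : 20 <= a -> has_code d a ->
  exists2 a', 4 * a <= a' + 18 & has_code (d + 5) a'.
Proof.
(* The largest admissible height; it is at least [a - 9], whence the loss of 18. *)
move=> a20 wa; pose h := (a - 5) %/ 10 * 10 + 5.
have [le_ha h5] : h <= a /\ h = 5 %[mod 10] by rewrite /h; lia.
by exists (2 * (a + h)); [rewrite /h; lia | apply: has_code_stair].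
Qed.

(** Three steps give at least [64 * a - 18 * (16 + 4 + 1)], and [25 * a >= 378]. *)
Lemma has_code_step3 d a : 20 <= a -> has_code d a ->
  exists2 a', 39 * a <= a' & has_code (d + 15) a'.
Proof.
move=> a20 /(has_code_step a20) [b le_b wb].
have [|c le_c wc] := has_code_step _ wb; first lia.
have [|e le_e we] := has_code_step _ wc; first lia.
by exists e; [lia | apply: has_code_pad we; lia].
Qed.

(** * The bound in cubed form and the base cases *)

Local Open Scope ring_scope.

Lemma powR3_bound (R : realType) (n N : nat) :
  40 ^+ 3 * 3 ^+ n <= 3 ^+ 8 * N%:R ^+ 3 :> R ->
  40 * 3 `^ ((n%:R - 8) / 3) <= N%:R :> R.
Proof.
move=> le_N; have p0 : 0 <= 3 `^ ((n%:R - 8) / 3) :> R by apply: powR_ge0.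
rewrite -(@ler_pXn2r _ 3) ?nnegrE ?mulr_ge0 ?ler0n //.
have -> : (40 * 3 `^ ((n%:R - 8) / 3)) ^+ 3 = 40 ^+ 3 * 3 ^+ n / 3 ^+ 8 :> R.
  rewrite exprMn -mulrA; congr (_ * _).
  rewrite -powR_mulrn // -powRrM divfK ?pnatr_eq0 //.
  by rewrite powRB ?pnatr_eq0 ?implybT // !powR_mulrn ?ler0n.
by rewrite ler_pdivrMr ?exprn_gt0 ?ltr0n // [leRHS]mulrC.
Qed.

(** Cubing the bound leaves only natural exponents; [20 <= N] keeps [has_code_step3] applicable
    along the induction. *)
Definition large (R : realType) (n N : nat) : bool :=
  (40 ^+ 3 * 3 ^+ n <= 3 ^+ 8 * N%:R ^+ 3 :> R) && (20 <= N)%N.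

Lemma large_step (R : realType) n N N' : (39 * N <= N')%N ->
  large R n N -> large R (n + 10) N'.
Proof.
move=> le_N /andP[leR N20]; rewrite /large; apply/andP; split; last by lia.
have le_R : 39 * N%:R <= N'%:R :> R by rewrite -natrM ler_nat.
have N0 : 0 <= N%:R :> R by [].
apply: (@le_trans _ _ (3 ^+ 8 * (39 * N%:R) ^+ 3)); last first.
  by rewrite ler_pM2l ?exprn_gt0 // lerXn2r ?nnegrE ?mulr_ge0.
rewrite exprD exprMn mulrA.
have c0 : 3 ^+ 10 <= 39 ^+ 3 :> R by lra.
have := ler_pM _ _ leR c0; rewrite !mulr_ge0 ?exprn_ge0 // => /(_ isT isT).
by rewrite -[X in _ <= X -> _]mulrA [_ * 39 ^+ 3]mulrC.
Qed.

Lemma base_codes (R : realType) n : (6 <= n < 16)%N ->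
  exists2 N, large R n N & has_code (153 * n %/ 100)%N N.
Proof.
have c4 : has_code 4 8 by eexists; apply: walk_code_cross4.
have c5 : has_code 5 10 by eexists; apply: walk_code_cross5.
have c8 : has_code 8 16 by eexists; apply: walk_code_cross8.
have c11 : has_code 11 40 by eexists; apply: walk_code_11_40.
(* Each height is the largest number congruent to 5 modulo 10 not exceeding the previous length. *)
have c9 : has_code 9 26 by apply: (@has_code_stair _ _ 5) c4.
have c14 : has_code 14 102 by apply: (@has_code_stair _ _ 25) c9.
have c19 : has_code 19 394 by apply: (@has_code_stair _ _ 95) c14.
have c10 : has_code 10 30 by apply: (@has_code_stair _ _ 5) c5.
have c15 : has_code 15 110 by apply: (@has_code_stair _ _ 25) c10.
have c13 : has_code 13 62 by apply: (@has_code_stair _ _ 15) c8.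
have c18 : has_code 18 234 by apply: (@has_code_stair _ _ 55) c13.
have c16 : has_code 16 150 by apply: (@has_code_stair _ _ 35) c11.
have c21 : has_code 21 590 by apply: (@has_code_stair _ _ 145) c16.
have c12 : has_code 12 40 by apply: has_code_pad c11.
have c22 : has_code 22 590 by apply: has_code_pad c21.
(* For n = 6, ..., 15 the dimensions are 9, 10, 12, 13, 15, 16, 18, 19, 21, 22. At n = 8 the bound
   is exactly 40. *)
do 6 case: n => // n.
case: n => [|[|[|[|[|[|[|[|[|[|n]]]]]]]]]] // _.
- by exists 26 => //; rewrite /large andbT; lra.
- by exists 30 => //; rewrite /large andbT; lra.
- by exists 40 => //; rewrite /large andbT; lra.
- by exists 62 => //; rewrite /large andbT; lra.
- by exists 110 => //; rewrite /large andbT; lra.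
- by exists 150 => //; rewrite /large andbT; lra.
- by exists 234 => //; rewrite /large andbT; lra.
- by exists 394 => //; rewrite /large andbT; lra.
- by exists 590 => //; rewrite /large andbT; lra.
- by exists 590 => //; rewrite /large andbT; lra.
Qed.

(** * Induction by tens and the two bounds *)

Lemma large_codes (R : realType) n : (6 <= n)%N ->
  exists2 N, large R n N & has_code (153 * n %/ 100)%N N.
Proof.
elim/ltn_ind: n => n IHn n6; have [n16|n16] := ltnP n 16.
  by apply: base_codes; rewrite n6.
have [||N lN wN] := IHn (n - 10)%N; [lia|lia|].
have [N' le_N wN'] := has_code_step3 (proj2 (andP lN)) wN.
exists N'; last by apply: has_code_pad wN'; lia.
by have -> : n = (n - 10 + 10)%N by [lia]; apply: large_step lN.
Qed.

Lemma truncn_ratio (R : realType) (p q n : nat) : (0 < q)%N ->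
  Num.truncn (p%:R / q%:R * n%:R : R) = (p * n %/ q)%N.
Proof.
move=> q0; have qR : 0 < q%:R :> R by rewrite ltr0n.
apply: truncn_def; rewrite mulrAC -natrM ler_pdivlMr // ltr_pdivrMr //.
by rewrite -!natrM ler_nat ltr_nat leq_trunc_div ltn_ceil.
Qed.

Theorem theorem2 (R : realType) (n : nat) (hn : (6 <= n)%N) :
  (K (Num.truncn (153 / 100 * n%:R : R)) 4)%:R
    >= 40 * 3 `^ ((n%:R - 8) / 3) :> R
  /\
  (K n 4)%:R
    >= 40 * 3 `^ (((Num.truncn (6535 / 10000 * n%:R : R))%:R - 8) / 3) :> R.
Proof.
have -> : 6535 / 10000 = 1307 / 2000 :> R by lra.
rewrite !truncn_ratio //.
have bound m d N : 40 ^+ 3 * 3 ^+ m <= 3 ^+ 8 * N%:R ^+ 3 :> R -> (4 <= N)%N ->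
    has_code d N -> 40 * 3 `^ ((m%:R - 8) / 3) <= (K d 4)%:R :> R.
  move=> /powR3_bound le_N N4 wN; apply: (le_trans le_N).
  by rewrite ler_nat has_code_leq_K.
have large_bound m d N : large R m N -> has_code d N ->
    40 * 3 `^ ((m%:R - 8) / 3) <= (K d 4)%:R :> R.
  by case/andP=> leN N20; apply: bound leN _; apply: leq_trans N20.
split; first by have [N lN] := large_codes R hn; apply: large_bound lN.
set m := (1307 * n %/ 2000)%N.
(* As [153 * 1307 <= 100 * 2000], the dimension used for [m] is at most [n]. *)
have [m6|m6] := leqP 6 m.
  have [N lN wN] := large_codes R m6; apply: large_bound lN _.
  by apply: has_code_pad wN; lia.
(* Here [m = 5] forces [n >= 8], and 16 exceeds 40/3. *)
have [m5|m4] := eqVneq m 5.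
  have c8 : has_code 8 16 by eexists; apply: walk_code_cross8.
  by apply: (bound _ _ 16) => //; [rewrite m5; lra | apply: has_code_pad c8; lia].
(* For [m <= 4] length 10 suffices, the bound at 4 being about 9.25. *)
have c5 : has_code 5 10 by eexists; apply: walk_code_cross5.
apply: (bound _ _ 10) => //; last by apply: has_code_pad c5; lia.
apply: (@le_trans _ _ (40 ^+ 3 * 3 ^+ 4)); last by lra.
by rewrite ler_pM2l ?exprn_gt0 // ler_weXn2l ?ler1n //; lia.
Qed.
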